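(* Let $n\in\mathbb{N}$ be a positive integer. Then \begin{align*} N_{(1,11)}(n) ={}& 8\,\sigma(n) - 32\,\sigma\!\left(\tfrac{n}{4}\right) + 8\,\sigma\!\left(\tfrac{n}{11}\right) - 32\,\sigma\!\left(\tfrac{n}{44}\right) \\ & + 64\, W_{(1,11)}(n) + 1024\, W_{(1,11)}\!\left(\tfrac{n}{4}\right) - 256\,\bigl( W_{(4,11)}(n) + W_{(1,44)}(n) \bigr), \end{align*} and \begin{align*} N_{(1,13)}(n) ={}& 8\,\sigma(n) - 32\,\sigma\!\left(\tfrac{n}{4}\right) + 8\,\sigma\!\left(\tfrac{n}{13}\right) - 32\,\sigma\!\left(\tfrac{n}{52}\right) \\ & + 64\, W_{(1,13)}(n) + 1024\, W_{(1,13)}\!\left(\tfrac{n}{4}\right) - 256\,\bigl( W_{(4,13)}(n) + W_{(1,52)}(n) \bigr). \end{align*}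
   Context: $\mathbb{N}$ denotes the positive integers and $\mathbb{N}_0$ the non-negative integers. For $n\in\mathbb{N}$, $\sigma(n)=\sum_{0<d\mid n} d$ is the sum of the positive divisors of $n$; by convention $\sigma(m)=0$ whenever $m\notin\mathbb{N}$ (so $\sigma(0)=0$ and $\sigma(n/t)=0$ when $t\nmid n$). For $\alpha,\beta\in\mathbb{N}$ with $\alpha\le\beta$, the convolution sum is $$W_{(\alpha,\beta)}(n)=\sum_{\substack{(l,m)\in\mathbb{N}_0^2\\ \alpha l+\beta m=n}}\sigma(l)\,\sigma(m).$$ The same formula is used with a rational argument: $W_{(\alpha,\beta)}(n/4)$ is the sum over $(l,m)\in\mathbb{N}_0^2$ with $\alpha l+\beta m=n/4$, which is an empty sum (value $0$) if $4\nmid n$. For $a,b\in\mathbb{N}$, $N_{(a,b)}(n)$ is the number of representations of $n$ by the octonary quadratic form $a(x_1^2+x_2^2+x_3^2+x_4^2)+b(x_5^2+x_6^2+x_7^2+x_8^2)$, that is, the number of $(x_1,\dots,x_8)\in\mathbb{Z}^8$ with $$n=a(x_1^2+x_2^2+x_3^2+x_4^2)+b(x_5^2+x_6^2+x_7^2+x_8^2).$$ *)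

(* Defs.v *)
From HB Require Import structures.
From mathcomp Require Import all_boot all_order all_algebra.
From mathcomp Require Import finmap boolp classical_sets functions cardinality.
From mathcomp Require Import fsbigop.

Set Implicit Arguments.
Unset Strict Implicit.
Unset Printing Implicit Defensive.

Import Order.TTheory GRing.Theory Num.Theory.

Local Open Scope classical_set_scope.
Local Open Scope ring_scope.

(* The range is explicit because [divisors 0] is [:: 1]; here
   [sum_divisors 0 = 0]. *)
Definition sum_divisors (n : nat) : nat :=
  (\sum_(1 <= d < n.+1 | d %| n) d)%N.

(* Arguments are rational, so that [n / 4] is a true quotient. *)
Definition sigma (q : rat) : int :=
  if q \is a Num.nat then (sum_divisors (Num.truncn q))%:Z else 0.

Definition convolution_pairs (a b : nat) (q : rat) : set (nat * nat) :=
  [set lm | a%:R * lm.1%:R + b%:R * lm.2%:R = q].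

(* [\sum_(_ \in A)] is 0 when the support is infinite; this does not occur for
   [a, b > 0], by [finite_convolution_pairs]. *)
Definition W (a b : nat) (q : rat) : int :=
  \sum_(lm \in convolution_pairs a b q) sigma lm.1%:R * sigma lm.2%:R.

(* [lshift 4 i] ranges over the first four coordinates, [rshift 4 i] over the
   last four. *)
Definition octonary_form (a b : nat) (x : {ffun 'I_(4 + 4) -> int}) : int :=
  a%:R * (\sum_(i < 4) x (lshift 4 i) ^+ 2)
  + b%:R * (\sum_(i < 4) x (rshift 4 i) ^+ 2).

Definition representations (a b n : nat) : set {ffun 'I_(4 + 4) -> int} :=
  [set x | n%:Z = octonary_form a b x].

(* [fset_set] is empty on infinite sets; this does not occur for [a, b > 0],
   by [finite_representations]. *)
Definition N (a b n : nat) : nat := #|` fset_set (representations a b n)|.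

Lemma finite_convolution_pairs (a b : nat) (q : rat) :
  (0 < a)%N -> (0 < b)%N -> finite_set (convolution_pairs a b q).
Proof.
move=> a0 b0; pose k := (Num.truncn q).+1.
apply: (sub_finite_set (B := `I_k `*` `I_k)); last first.
  by apply: finite_setX; apply: finite_II.
move=> [l m] /= e; have {}e : (a * l + b * m)%N%:R = q.
  by rewrite natrD !natrM.
rewrite /k -e natrK !ltnS; split.
  by apply: leq_trans (leq_addr _ _); rewrite leq_pmull.
by apply: leq_trans (leq_addl _ _); rewrite leq_pmull.
Qed.

Lemma finite_representations (a b n : nat) :
  (0 < a)%N -> (0 < b)%N -> finite_set (representations a b n).
Proof.
move=> a0 b0.
pose f (g : {ffun 'I_(4 + 4) -> bool * 'I_n.+1}) : {ffun 'I_(4 + 4) -> int} :=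
  [ffun i => (-1) ^+ (g i).1 * (val (g i).2)%:Z].
apply: (sub_finite_set (B := f @` setT)); last first.
  exact: finite_image finite_finset.
move=> x /= e.
have sq (z : int) : `|z| <= z ^+ 2.
  rewrite -real_normK ?num_real // -abszE expr2 -PoszM lez_nat.
  by case: `|z|%N => // k; rewrite leq_pmull.
have part (c : nat) (F : 'I_4 -> int) i : (0 < c)%N ->
    `|F i| <= c%:R * (\sum_(j < 4) F j ^+ 2).
  move=> c0; apply: (le_trans (sq _)).
  have s : F i ^+ 2 <= \sum_(j < 4) F j ^+ 2.
    by rewrite (bigD1 i) //= lerDl sumr_ge0 // => j _; rewrite sqr_ge0.
  apply: (le_trans s); rewrite ler_peMl ?ler1n //.
  by rewrite sumr_ge0 // => j _; rewrite sqr_ge0.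
have pos (c : nat) (F : 'I_4 -> int) : 0 <= c%:R * (\sum_(j < 4) F j ^+ 2).
  by rewrite mulr_ge0 // sumr_ge0 // => j _; rewrite sqr_ge0.
have bd (i : 'I_(4 + 4)) : (`|x i| < n.+1)%N.
  rewrite ltnS -lez_nat abszE e /octonary_form -[i](@splitK 4 4).
  case: (fintype.split i) => j /=.
    apply: (le_trans (part a (fun j => x (lshift 4 j)) j a0)).
    by rewrite lerDl (pos _ (fun j => x (rshift 4 j))).
  apply: (le_trans (part b (fun j => x (rshift 4 j)) j b0)).
  by rewrite lerDr (pos _ (fun j => x (lshift 4 j))).
exists [ffun i => (x i < 0, Ordinal (bd i))] => //.
by apply/ffunP => i; rewrite !ffunE /= -intEsign.
Qed.

(* Main.v *)
(** By Jacobi's four square theorem, [x1^2 + x2^2 + x3^2 + x4^2] represents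
    [n > 0] exactly [8 sigma(n) - 32 sigma(n/4)] times; expanding the product of
    two such counts over [n = l + b m] gives the formula for [N 1 b n], with
    the terms [l = 0] and [m = 0] producing the isolated divisor sums.

    Jacobi's theorem is proved by a recurrence. With [theta] the generating
    polynomial of the squares, [(theta^4)' theta = 4 theta^4 theta'] says that
    the coefficients [r] of [theta^4] satisfy
    [sum_i (n - 5 i^2) r(n - i^2) = 0], which determines [r] from [r 0 = 1]. The
    divisor function satisfies the same recurrence, by an identity of
    Liouville-Uspensky type: for [F] odd in [x] and even in [(y, z)], the sums over
    [i^2 + d e = n] of [F(d + e, i, d - e)] and of
    [2 F(e - 2i, d + i, 2d + 2i - e)] agree up to terms that occur only when [n] is a
    square, since both run over the quadric [4 n = 4 y^2 + x^2 - z^2] and differ by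
    regions exchanged by [x -> -x] and [(y, z) -> (-y, -z)]. It is applied to
    [F = eps(x) x (x^2 - z^2 - 16 y^2)] with [eps] depending on the parity of [x]. *)
Require Import Defs.
From mathcomp Require Import all_boot all_order all_algebra zify ring.
From mathcomp Require Import finmap boolp classical_sets cardinality fsbigop.

Set Implicit Arguments.
Unset Strict Implicit.
Unset Printing Implicit Defensive.

Import Order.TTheory GRing.Theory Num.Theory.

Local Open Scope ring_scope.

(** * Finite sums over the triples with [i^2 + d e = n] *)

Lemma big_seq_bij (T T' : eqType) (V : zmodType) (s : seq T) (s' : seq T')
    (P : pred T) (Q : pred T') (f : T -> T') (g : T' -> T) (F : T' -> V) :
  uniq s -> uniq s' ->
  (forall t, t \in s -> P t -> [/\ f t \in s', Q (f t) & g (f t) = t]) ->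
  (forall t, t \in s' -> Q t -> [/\ g t \in s, P (g t) & f (g t) = t]) ->
  \sum_(t <- s | P t) F (f t) = \sum_(t <- s' | Q t) F t.
Proof.
move=> us us' fP gQ; rewrite -big_filter -[RHS]big_filter.
rewrite -(big_map f xpredT F); apply: perm_big; apply: uniq_perm.
- rewrite map_inj_in_uniq ?filter_uniq // => x y.
  rewrite !mem_filter => /andP[Px xs] /andP[Py ys] e.
  by have [_ _ <-] := fP _ xs Px; rewrite e; have [] := fP _ ys Py.
- exact: filter_uniq.
move=> t; rewrite mem_filter; apply/mapP/andP => [[x]|[Qt ts]].
  by rewrite mem_filter => /andP[Px xs] ->; have [] := fP _ xs Px.
have [gs Pg e] := gQ _ ts Qt.
by exists (g t); rewrite ?e // mem_filter Pg.
Qed.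

Lemma abszX2 (i : int) : (`|i| ^ 2)%N%:Z = i ^+ 2.
Proof. by rewrite -mulnn PoszM -expr2 abszE real_normK ?num_real. Qed.

Definition int_range (n : nat) : seq int :=
  [seq j%:Z - n%:Z | j <- iota 0 n.*2.+1].

Lemma mem_int_range (n : nat) (i : int) : (i \in int_range n) = (`|i| <= n)%N.
Proof.
apply/mapP/idP => [[j]|le]; first by rewrite mem_iota => jn ->; lia.
exists (absz (i + n%:Z)); last by lia.
by rewrite mem_iota; lia.
Qed.

Lemma int_range_uniq (n : nat) : uniq (int_range n).
Proof. by rewrite map_inj_uniq ?iota_uniq // => x y; lia. Qed.

(* The [(i, d, e)] with [i ^ 2 + d * e = n] and [d, e > 0]; the truncated
   subtraction yields no divisors when [n <= i ^ 2]. *)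
Definition square_div_triples (n : nat) : seq (int * int * int) :=
  [seq (i, d%:Z, ((n - `|i| ^ 2) %/ d)%N%:Z)
  | i <- int_range n,
    d <- [seq d <- index_iota 1 (n - `|i| ^ 2).+1 | (d %| n - `|i| ^ 2)%N]].

Lemma mem_square_div_triples (n : nat) (i d e : int) :
  ((i, d, e) \in square_div_triples n) =
  [&& i ^+ 2 + d * e == n%:Z, 0 < d & 0 < e].
Proof.
apply/allpairsPdep/and3P => [[j [c []]]|[/eqP E d0 e0]].
  rewrite mem_int_range mem_filter mem_index_iota => jn /andP[dv /andP[c0 cn]].
  case=> -> -> ->; have q := divnK dv.
  set k := (_ %/ c)%N in q *; have k0 : (0 < k)%N.
    by rewrite lt0n; apply/eqP => z; rewrite z mul0n in q; lia.
  split; [|lia|lia]; apply/eqP.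
  have : (`|j| ^ 2 < n)%N by lia.
  rewrite -abszX => h; have : `|j ^+ 2|%N%:Z = j ^+ 2 by rewrite abszE ger0_norm ?sqr_ge0.
  by move: q h; rewrite -abszX; lia.
have sq : `|i ^+ 2|%N%:Z = i ^+ 2 by rewrite abszE ger0_norm ?sqr_ge0.
have de : (`|d| * `|e| = n - `|i| ^ 2)%N by rewrite -abszX; move: sq; lia.
have lt : (`|i| ^ 2 < n)%N by have: (0 < `|d| * `|e|)%N; lia.
exists i, `|d|%N; rewrite mem_int_range mem_filter mem_index_iota -de.
rewrite dvdn_mulr // mulKn; last by lia.
split; [nia|nia|].
by congr (_, _, _); lia.
Qed.

Lemma square_div_triples_uniq (n : nat) : uniq (square_div_triples n).
Proof.
apply: allpairs_uniq_dep => [|i _|]; first exact: int_range_uniq.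
  by rewrite filter_uniq // iota_uniq.
by move=> [i d] [j c] _ _ /= [-> -> _].
Qed.

(** * The identity of Liouville-Uspensky type *)

(** On the quadric [4 n = 4 y^2 + x^2 - z^2], [H] runs over the region [|z| < x] and [G] over
    [-x < z < 2y]. In the second region the part [z > x] is stable under [x -> -x] and cancels. The
    part [z < x] is the half [z < 2y] of the first region, and the other half has the same sum by
    [(y, z) -> (-y, -z)]. The planes [z = 2y] and [z = x] give the two corrections. *)
Lemma sum_square_div_triples_split (n : nat) (F : int -> int -> int -> int) :
  (forall x y z, F (- x) y z = - F x y z) ->
  (forall x y z, F x (- y) (- z) = F x y z) ->
  let H t : int := F (t.1.2 + t.2) t.1.1 (t.1.2 - t.2) in
  let G t : int :=
    F (t.2 - 2 * t.1.1) (t.1.2 + t.1.1) (2 * t.1.2 + 2 * t.1.1 - t.2) in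
  \sum_(t <- square_div_triples n) H t =
  2 * (\sum_(t <- square_div_triples n) G t)
  + \sum_(t <- square_div_triples n | t.1.2 - t.2 == 2 * t.1.1) H t
  - 2 * (\sum_(t <- square_div_triples n | t.1.2 + 2 * t.1.1 == t.2) G t).
Proof.
move=> Fx Fyz H G; set s := square_div_triples n.
have us : uniq s := square_div_triples_uniq n.
(* The sign change of [x] preserves [(y, z)] and the region [z > |x|]. *)
have cancelled : \sum_(t <- s | t.2 < t.1.2 + 2 * t.1.1) G t = 0.
  suff : \sum_(t <- s | t.2 < t.1.2 + 2 * t.1.1) G t =
         - \sum_(t <- s | t.2 < t.1.2 + 2 * t.1.1) G t by lia.
  pose f t : int * int * int := (t.2 - t.1.1, t.1.2 + 2 * t.1.1 - t.2, t.2).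
  rewrite -[LHS](@big_seq_bij _ _ _ s s (fun t => t.2 < t.1.2 + 2 * t.1.1) _ f f) //.
  - rewrite -sumrN; apply: eq_bigr => -[[i d] e] _.
    by rewrite /G /f /= -Fx; congr F; ring.
  - move=> [[i d] e]; rewrite /f /= !mem_square_div_triples.
    move=> /and3P[/eqP E d0 e0] lt; split; [|lia|congr (_, _, _); lia].
    by apply/and3P; split; [apply/eqP; rewrite -E; ring|lia|lia].
  move=> [[i d] e]; rewrite /f /= !mem_square_div_triples.
  move=> /and3P[/eqP E d0 e0] lt; split; [|lia|congr (_, _, _); lia].
  by apply/and3P; split; [apply/eqP; rewrite -E; ring|lia|lia].
(* Both sides run over the points with [|z| < x] and [z < 2y]; [f] passes from the parametrization
   of [G] to that of [H]. *)
have lower : \sum_(t <- s | t.1.2 + 2 * t.1.1 < t.2) G t =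
             \sum_(t <- s | t.1.2 - t.2 < 2 * t.1.1) H t.
  pose f t : int * int * int := (t.1.2 + t.1.1, t.1.2, t.2 - 2 * t.1.1 - t.1.2).
  pose g t : int * int * int := (t.1.1 - t.1.2, t.1.2, 2 * t.1.1 + t.2 - t.1.2).
  rewrite -[RHS](@big_seq_bij _ _ _ s s (fun t => t.1.2 + 2 * t.1.1 < t.2) _ f g) //.
  - apply: eq_bigr => -[[i d] e] _.
    by rewrite /G /H /f /=; congr F; ring.
  - move=> [[i d] e]; rewrite /f /g /= !mem_square_div_triples.
    move=> /and3P[/eqP E d0 e0] lt; split; [|lia|congr (_, _, _); lia].
    by apply/and3P; split; [apply/eqP; rewrite -E; ring|lia|lia].
  move=> [[i d] e]; rewrite /f /g /= !mem_square_div_triples.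
  move=> /and3P[/eqP E d0 e0] lt; split; [|lia|congr (_, _, _); lia].
  by apply/and3P; split; [apply/eqP; rewrite -E; ring|lia|lia].
have swapped : \sum_(t <- s | 2 * t.1.1 < t.1.2 - t.2) H t =
             \sum_(t <- s | t.1.2 - t.2 < 2 * t.1.1) H t.
  pose f t : int * int * int := (- t.1.1, t.2, t.1.2).
  rewrite -[RHS](@big_seq_bij _ _ _ s s (fun t => 2 * t.1.1 < t.1.2 - t.2) _ f f) //.
  - apply: eq_bigr => -[[i d] e] _.
    by rewrite /H /f /= -Fyz; congr F; ring.
  - move=> [[i d] e]; rewrite /f /= !mem_square_div_triples.
    move=> /and3P[/eqP E d0 e0] lt; split; [|lia|congr (_, _, _); lia].
    by apply/and3P; split; [apply/eqP; rewrite -E; ring|lia|lia].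
  move=> [[i d] e]; rewrite /f /= !mem_square_div_triples.
  move=> /and3P[/eqP E d0 e0] lt; split; [|lia|congr (_, _, _); lia].
  by apply/and3P; split; [apply/eqP; rewrite -E; ring|lia|lia].
have splitH : \sum_(t <- s) H t =
    \sum_(t <- s | t.1.2 - t.2 < 2 * t.1.1) H t
    + \sum_(t <- s | 2 * t.1.1 < t.1.2 - t.2) H t
    + \sum_(t <- s | t.1.2 - t.2 == 2 * t.1.1) H t.
  rewrite [in RHS]big_mkcond [X in _ + X + _]big_mkcond [X in _ + X]big_mkcond.
  by rewrite -!big_split /=; apply: eq_bigr => t _; case: ltgtP => _; ring.
have splitG : \sum_(t <- s) G t =
    \sum_(t <- s | t.1.2 + 2 * t.1.1 < t.2) G t
    + \sum_(t <- s | t.2 < t.1.2 + 2 * t.1.1) G t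
    + \sum_(t <- s | t.1.2 + 2 * t.1.1 == t.2) G t.
  rewrite [in RHS]big_mkcond [X in _ + X + _]big_mkcond [X in _ + X]big_mkcond.
  by rewrite -!big_split /=; apply: eq_bigr => t _; case: ltgtP => _; ring.
by rewrite splitH splitG cancelled lower swapped; ring.
Qed.

(** * The test function and its boundary terms *)

(* The values [2] and [-3] are the solution of the linear system that makes
   [sum_pair_weight] yield a multiple of [sigma(n) - 4 sigma(n/4)]. *)
Definition parity_weight (x : int) : int := if odd `|x| then 2 else -3.

Lemma parity_weightN (x : int) : parity_weight (- x) = parity_weight x.
Proof. by rewrite /parity_weight abszN. Qed.

Lemma parity_weightD (x y : int) :
  parity_weight (x + y) = if odd `|x| (+) odd `|y| then 2 else -3.
Proof. by rewrite /parity_weight; congr (if _ then _ else _); lia. Qed.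

Lemma parity_weightD_even (x y : int) :
  parity_weight (x + 2 * y) = parity_weight x.
Proof. by rewrite /parity_weight; congr (if _ then _ else _); lia. Qed.

(** On the quadric, [x^2 - z^2 - 16 y^2] equals [4 (n - 5 y^2)], the factor of the recurrence for
    the coefficients of [theta^4]. *)
Definition cubic_weight (x y z : int) : int :=
  parity_weight x * (x * (x ^+ 2 - z ^+ 2 - 16 * y ^+ 2)).

(** The factor 6 clears the denominators in the sums of [j] and [j^2]. *)
Lemma sum_cubic_weight_diagonal (k : int) (m : nat) :
  6 * (\sum_(1 <= j < m.+1) (k ^+ 2 - 5 * (j%:Z - k) ^+ 2)) =
  6 * k ^+ 2 * m%:Z - 5 * m%:Z * (m%:Z + 1) * (2 * m%:Z + 1)
  + 30 * k * m%:Z * (m%:Z + 1) - 30 * m%:Z * k ^+ 2.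
Proof.
elim: m => [|m IH]; first by rewrite big_geq //; ring.
by rewrite big_nat_recr //= mulrDr IH intS; ring.
Qed.

Lemma sum_parity_weight (k : nat) :
  \sum_(1 <= j < k.*2.+2) parity_weight j%:Z * j%:Z =
  3 * k.+1%:Z - k.+1%:Z ^+ 2.
Proof.
elim: k => [|k IH]; first by rewrite big_nat1.
rewrite doubleS big_nat_recr //= big_nat_recr //= IH /parity_weight /=.
by rewrite negbK odd_double /=; rewrite -muln2 !intS; ring.
Qed.

(** On the boundaries, [i^2 + d e] is a perfect square: [(d - i)^2] if [d - e = 2i], and [(d + i)^2]
    if [d + 2i = e]. *)
Lemma sum_square_div_triples_nonsquare (n : nat) (F : int * int * int -> int) :
  (forall k, (k ^ 2)%N != n) ->
  \sum_(t <- square_div_triples n | t.1.2 - t.2 == 2 * t.1.1) F t = 0 /\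
  \sum_(t <- square_div_triples n | t.1.2 + 2 * t.1.1 == t.2) F t = 0.
Proof.
move=> nsq.
have no (y : int) : y ^+ 2 = n%:Z -> False.
  move=> e; case/eqP: (nsq `|y|%N); rewrite -abszX e; lia.
split; rewrite big_seq_cond big1 // => -[[i d] e] /=;
  rewrite mem_square_div_triples => /andP[/and3P[/eqP E _ _] /eqP h].
- by case: (no (d - i)); rewrite -E (_ : e = d - 2 * i); [ring|lia].
- by case: (no (d + i)); rewrite -E -h; ring.
Qed.

(** Each boundary is a segment parametrized by [j = d] with [0 < j < 2k], since [d - i = k] on the
    first and [d + i = k] on the second. In the total the terms in [k^3] and [k^4] cancel. *)
Lemma sum_cubic_weight_square (k : nat) : (0 < k)%N ->
  let s := square_div_triples (k ^ 2) in
  \sum_(t <- s | t.1.2 - t.2 == 2 * t.1.1)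
    cubic_weight (t.1.2 + t.2) t.1.1 (t.1.2 - t.2)
  - 2 * (\sum_(t <- s | t.1.2 + 2 * t.1.1 == t.2)
    cubic_weight (t.2 - 2 * t.1.1) (t.1.2 + t.1.1)
      (2 * t.1.2 + 2 * t.1.1 - t.2)) = 40 * k%:Z ^+ 2.
Proof.
move=> k0 s; have us : uniq s := square_div_triples_uniq _.
have sqr_inj (y : int) : y ^+ 2 = (k ^ 2)%N -> 0 < y -> y = k%:Z by nia.
pose r := index_iota 1 k.*2.
have ur : uniq r := iota_uniq _ _.
pose f1 (j : nat) : int * int * int := (j%:Z - k%:Z, j%:Z, 2 * k%:Z - j%:Z).
pose f2 (j : nat) : int * int * int := (k%:Z - j%:Z, j%:Z, 2 * k%:Z - j%:Z).
rewrite -(@big_seq_bij _ _ _ r s xpredT _ f1 (fun t => `|t.1.2|%N)) //; first last.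
- move=> [[i d] e]; rewrite /r /f1 /= mem_square_div_triples mem_index_iota.
  move=> /and3P[/eqP E d0 e0] /eqP h.
  have y : (d - i) = k%:Z.
    by apply: sqr_inj; [rewrite -E (_ : e = d - 2 * i); [ring|lia]|lia].
  by split=> //; [lia|congr (_, _, _); lia].
- move=> j; rewrite /r /f1 /= mem_square_div_triples mem_index_iota => jk _.
  split=> //; [apply/and3P; split; [apply/eqP|lia|lia]|lia].
  by rewrite -mulnn PoszM; ring.
rewrite -(@big_seq_bij _ _ _ r s xpredT _ f2 (fun t => `|t.1.2|%N)) //; first last.
- move=> [[i d] e]; rewrite /r /f2 /= mem_square_div_triples mem_index_iota.
  move=> /and3P[/eqP E d0 e0] /eqP h.
  have y : (d + i) = k%:Z by apply: sqr_inj; [rewrite -E -h; ring|lia].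
  by split=> //; [lia|congr (_, _, _); lia].
- move=> j; rewrite /r /f2 /= mem_square_div_triples mem_index_iota => jk _.
  split=> //; [apply/and3P; split; [apply/eqP|lia|lia]|lia].
  by rewrite -mulnn PoszM; ring.
rewrite /f1 /f2 /=.
(* Here [x = 2k] is even, so the parity weight is constantly -3, and [z = 2y]. *)
have -> : \sum_(j <- r) cubic_weight (j%:Z + (2 * k%:Z - j%:Z)) (j%:Z - k%:Z)
    (j%:Z - (2 * k%:Z - j%:Z)) =
    - 24 * k%:Z * \sum_(j <- r) (k%:Z ^+ 2 - 5 * (j%:Z - k%:Z) ^+ 2).
  rewrite mulr_sumr; apply: eq_bigr => j _; rewrite /cubic_weight.
  rewrite (_ : parity_weight _ = -3); first by ring.
  by rewrite (_ : j%:Z + _ = 0 + 2 * k%:Z) ?parity_weightD_even //; ring.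
(* Here [x = z = j] and [y = k], so only the term [-16 y^2] of the second factor survives. *)
have -> : \sum_(j <- r) cubic_weight (2 * k%:Z - j%:Z - 2 * (k%:Z - j%:Z))
    (j%:Z + (k%:Z - j%:Z)) (2 * j%:Z + 2 * (k%:Z - j%:Z) - (2 * k%:Z - j%:Z)) =
    - 16 * k%:Z ^+ 2 * \sum_(j <- r) parity_weight j%:Z * j%:Z.
  rewrite mulr_sumr; apply: eq_bigr => j _; rewrite /cubic_weight.
  by rewrite (_ : 2 * k%:Z - j%:Z - _ = j%:Z); ring.
rewrite /r; case: k k0 @r ur @s us sqr_inj @f1 @f2 => // k _ _ _ _ _ _ _ _.
rewrite doubleS sum_parity_weight.
rewrite (_ : -24 * k.+1%:Z = -4 * k.+1%:Z * 6); last by ring.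
by rewrite -mulrA sum_cubic_weight_diagonal -muln2 !intS PoszM; ring.
Qed.

(** * Divisor sums and their recurrence *)

Definition sum_divisors_quot (t n : nat) : nat :=
  if (t %| n)%N then sum_divisors (n %/ t) else 0%N.

(** For [n > 0], one eighth of the number of representations by four squares in Jacobi's theorem;
    the value at 0 is 0. *)
Definition four_square_divisor_sum (n : nat) : int :=
  (sum_divisors n)%:Z - 4 * (sum_divisors_quot 4 n)%:Z.

Lemma sum_divisorsE (n : nat) : (0 < n)%N ->
  (sum_divisors n)%:Z = \sum_(d <- divisors n) d%:Z.
Proof.
move=> n0; rewrite /sum_divisors (big_morph Posz PoszD (erefl 0%:Z)).
apply: (@big_seq_bij _ _ _ _ _ _ xpredT id id Posz);
  rewrite ?iota_uniq ?divisors_uniq //.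
- by move=> d _ dn; rewrite -dvdn_divisors.
- move=> d; rewrite -dvdn_divisors // mem_index_iota => dn _.
  by rewrite (dvdn_gt0 n0) // ltnS dvdn_leq.
Qed.

(** Writing [d = u c] matches these divisors of [n] with the divisors [c] of [n / (u t)]; there are
    none when [u t] does not divide [n]. *)
Lemma sum_divisors_scaled (u t n : nat) : (0 < n)%N -> (0 < u)%N -> (0 < t)%N ->
  \sum_(d <- divisors n | (u %| d)%N && (t %| n %/ d)%N) d%:Z =
  u%:Z * (sum_divisors_quot (u * t) n)%:Z.
Proof.
move=> n0 u0 t0; rewrite /sum_divisors_quot; case: ifP => [/dvdnP[m E]|nd]; last first.
  rewrite mulr0 big_seq_cond big1 // => d /andP[].
  rewrite -dvdn_divisors // => dn /andP[ud td].
  by rewrite -(divnK dn) mulnC dvdn_mul in nd.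
have m0 : (0 < m)%N by move: n0; rewrite E; case: (m).
rewrite [in RHS]E mulnK ?muln_gt0 ?u0 // sum_divisorsE // mulr_sumr.
rewrite -(@big_seq_bij _ _ _ (divisors m) (divisors n) xpredT _ (muln u)
  (divn^~ u) Posz) ?divisors_uniq //.
  move=> d; rewrite -!dvdn_divisors // => /dvdnP[c mE] _.
  have d0 : (0 < d)%N by move: m0; rewrite mE; case: d {mE} => //; rewrite muln0.
  have nE : n = (c * t * (u * d))%N by rewrite E mE; ring.
  by rewrite dvdn_mulr // nE dvdn_mull // mulnK ?muln_gt0 ?u0 // dvdn_mull // mulKn.
move=> d; rewrite -!dvdn_divisors // => /dvdnP[c nE] /andP[/dvdnP[a dE]].
have d0 : (0 < d)%N by move: n0; rewrite nE; case: d {dE nE} => //; rewrite muln0.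
rewrite {1}nE mulnK // => /dvdnP[b cE].
rewrite dE mulnK // mulnC; split=> //.
apply/dvdnP; exists b; apply/eqP; rewrite -(eqn_pmul2r (_ : 0 < u * t)%N) ?muln_gt0 ?u0 //.
by rewrite -E nE cE dE; apply/eqP; ring.
Qed.

(** The total weight of [d (n - 5 i^2)] once both sides of the splitting identity have been
    symmetrized and subtracted. *)
Definition pair_weight (d e : int) : int :=
  parity_weight (d + e) - parity_weight d + 5 * parity_weight e.

Lemma sum_pair_weight (n : nat) : (0 < n)%N ->
  \sum_(d <- divisors n) d%:Z * pair_weight d%:Z (n %/ d)%N%:Z =
  5 * four_square_divisor_sum n.
Proof.
move=> n0; have S := sum_divisors_scaled n0.
(* With [e = n / d], the weight depends only on parities: 5 for [d], [e] odd, 15 for [d] even and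
   [e] odd, -15 for [e] even. Written in the indicators of [2 | d] and [2 | e], it makes the two
   multiples of [sigma(n/2)] cancel. *)
have -> : \sum_(d <- divisors n) d%:Z * pair_weight d%:Z (n %/ d)%N%:Z =
  5 * (\sum_(d <- divisors n | (1 %| d)%N && (1 %| n %/ d)%N) d%:Z
  + 2 * (\sum_(d <- divisors n | (2 %| d)%N && (1 %| n %/ d)%N) d%:Z)
  - 2 * (\sum_(d <- divisors n | (2 %| d)%N && (2 %| n %/ d)%N) d%:Z)
  - 4 * (\sum_(d <- divisors n | (1 %| d)%N && (2 %| n %/ d)%N) d%:Z)).
  rewrite [X in 5 * (X + _ - _ - _)]big_mkcond [X in 5 * (_ + 2 * X - _ - _)]big_mkcond.
  rewrite [X in 5 * (_ - 2 * X - _)]big_mkcond [X in 5 * (_ - 4 * X)]big_mkcond.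
  rewrite !mulr_sumr -!sumrN -!big_split mulr_sumr; apply: eq_bigr => d _ /=.
  rewrite /pair_weight parity_weightD /parity_weight !dvdn2 !dvd1n /=.
  by case: (odd d); case: (odd _) => /=; ring.
rewrite !S // /four_square_divisor_sum /sum_divisors_quot !muln1 !mul1n divn1 /=.
by rewrite dvd1n (_ : (2 * 2)%N = 4%N) //; ring.
Qed.

Lemma four_square_divisor_sum0 : four_square_divisor_sum 0 = 0.
Proof. by rewrite /four_square_divisor_sum /sum_divisors_quot /sum_divisors big_geq. Qed.

Lemma sum_square_div_triples (n : nat) (w : int -> int -> int -> int) :
  \sum_(t <- square_div_triples n) w t.1.1 t.1.2 t.2 =
  \sum_(i <- int_range n | (`|i| ^ 2 < n)%N)
    \sum_(d <- divisors (n - `|i| ^ 2))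
      w i d%:Z ((n - `|i| ^ 2) %/ d)%N%:Z.
Proof.
rewrite /square_div_triples big_allpairs_dep /= [RHS]big_mkcond; apply: eq_bigr => i _.
case: ltnP => [lt|le]; last first.
  by move/eqP: le => -> ; rewrite big_filter big_geq.
rewrite big_filter.
apply: (@big_seq_bij _ _ _ _ _ _ xpredT id id (fun d => w i d%:Z ((n - `|i| ^ 2) %/ d)%N%:Z));
  rewrite ?iota_uniq ?divisors_uniq //.
- by move=> d _ dn; rewrite -dvdn_divisors // subn_gt0.
- move=> d; rewrite -dvdn_divisors ?subn_gt0 // mem_index_iota => dn _.
  by rewrite (dvdn_gt0 _ dn) ?subn_gt0 // ltnS dvdn_leq // subn_gt0.
Qed.

(** This is the splitting identity for [cubic_weight], divided by 40; the right-hand side is the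
    boundary term [40 k^2] of [n = k^2]. *)
Lemma four_square_divisor_sum_rec (n : nat) : (0 < n)%N ->
  \sum_(i <- int_range n | (`|i| ^ 2 < n)%N)
    (n%:Z - 5 * i ^+ 2) * four_square_divisor_sum (n - `|i| ^ 2) =
  if [exists k : 'I_n.+1, (k ^ 2)%N == n] then n%:Z else 0.
Proof.
move=> n0; set s := square_div_triples n.
have us : uniq s := square_div_triples_uniq n.
have mem := mem_square_div_triples n.
have oddF x y z : cubic_weight (- x) y z = - cubic_weight x y z.
  by rewrite /cubic_weight parity_weightN; ring.
have evenF x y z : cubic_weight x (- y) (- z) = cubic_weight x y z.
  by rewrite /cubic_weight; ring.
have swap (w : int -> int -> int -> int) :
    \sum_(t <- s) w t.1.1 t.1.2 t.2 = \sum_(t <- s) w t.1.1 t.2 t.1.2.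
  pose f (t : int * int * int) : int * int * int := (t.1.1, t.2, t.1.2).
  rewrite -(@big_seq_bij _ _ _ s s xpredT xpredT f f) // => -[[i d] e];
    by rewrite /f /= !mem => /and3P[/eqP E d0 e0] _; rewrite -E mulrC d0 e0 eqxx.
(* Only the part of the integrand that is even in [i] contributes. *)
have neg (w : int -> int -> int -> int) :
    \sum_(t <- s) w t.1.1 t.1.2 t.2 = \sum_(t <- s) w (- t.1.1) t.1.2 t.2.
  pose f (t : int * int * int) : int * int * int := (- t.1.1, t.1.2, t.2).
  rewrite -(@big_seq_bij _ _ _ s s xpredT xpredT f f) // => -[[i d] e];
    by rewrite /f /= !mem sqrrN opprK.
have := sum_square_div_triples_split n oddF evenF.
rewrite /= -/s.
(* The integrand is [4 (d + e) (n - 5 i^2)] times a weight symmetric in [d] and [e], so [swap]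
   replaces [d + e] by [2 d]. *)
have -> : \sum_(t <- s) cubic_weight (t.1.2 + t.2) t.1.1 (t.1.2 - t.2) =
    8 * \sum_(t <- s) parity_weight (t.1.2 + t.2) * t.1.2 * (n%:Z - 5 * t.1.1 ^+ 2).
  have -> : \sum_(t <- s) cubic_weight (t.1.2 + t.2) t.1.1 (t.1.2 - t.2) =
    4 * (\sum_(t <- s) parity_weight (t.1.2 + t.2) * t.1.2 * (n%:Z - 5 * t.1.1 ^+ 2)
    + \sum_(t <- s) parity_weight (t.1.2 + t.2) * t.2 * (n%:Z - 5 * t.1.1 ^+ 2)).
    rewrite -big_split mulr_sumr; apply: eq_big_seq => -[[i d] e] /=.
    by rewrite mem => /and3P[/eqP <- _ _]; rewrite /cubic_weight; ring.
  rewrite [X in _ + X](swap (fun i d e => parity_weight (d + e) * e * (n%:Z - 5 * i ^+ 2))) /=.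
  under [X in _ + X]eq_bigr do rewrite addrC.
  by ring.
(* Adding the values at [i] and [-i] and using [n = i^2 + d e] leaves [8 (e - 5 d) (n - 5 i^2)]
   times the parity weight of [e]; [swap] then turns the term in [e] into one in [d]. *)
have -> : \sum_(t <- s) cubic_weight (t.2 - 2 * t.1.1) (t.1.2 + t.1.1)
      (2 * t.1.2 + 2 * t.1.1 - t.2) =
    4 * \sum_(t <- s) (parity_weight t.1.2 - 5 * parity_weight t.2) * t.1.2
      * (n%:Z - 5 * t.1.1 ^+ 2).
  pose w (i d e : int) := cubic_weight (e - 2 * i) (d + i) (2 * d + 2 * i - e).
  suff : \sum_(t <- s) w t.1.1 t.1.2 t.2 + \sum_(t <- s) w (- t.1.1) t.1.2 t.2 =
     8 * (\sum_(t <- s) parity_weight t.2 * t.2 * (n%:Z - 5 * t.1.1 ^+ 2)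
     - 5 * \sum_(t <- s) parity_weight t.2 * t.1.2 * (n%:Z - 5 * t.1.1 ^+ 2)).
    rewrite -(neg w) (swap (fun i d e => parity_weight e * e * (n%:Z - 5 * i ^+ 2))) /=.
    under [X in _ = 4 * X]eq_bigr do rewrite mulrBl mulrBl -!mulrA.
    rewrite sumrB -mulr_sumr.
    under [X in 8 * (X - _)]eq_bigr do rewrite -!mulrA.
    under [X in 8 * (_ - 5 * X)]eq_bigr do rewrite -!mulrA.
    have half (x y : int) : x + x = 8 * y -> x = 4 * y by lia.
    exact: half.
  rewrite mulr_sumr -big_split -sumrB mulr_sumr; apply: eq_big_seq => -[[i d] e] /=.
  rewrite mem => /and3P[/eqP <- _ _]; rewrite /w /cubic_weight.
  rewrite -mulrN !parity_weightD_even.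
  rewrite (_ : - (2 * - i) = 2 * i) ?parity_weightD_even; ring.
set A := \sum_(t <- s) _; set B := \sum_(t <- s) _.
set C := (X in _ -> X = _).
have : A - B = 5 * C.
  rewrite /A /B -sumrB.
  pose w i d e := (n%:Z - 5 * i ^+ 2) * (d * pair_weight d e).
  rewrite (eq_bigr (fun t => w t.1.1 t.1.2 t.2)); last first.
    by move=> t _; rewrite /w /pair_weight; ring.
  rewrite (sum_square_div_triples n w) /w /C mulr_sumr; apply: eq_bigr => i lt.
  by rewrite -mulr_sumr sum_pair_weight ?subn_gt0 //; ring.
(* The boundary term [u - 2 v] equals [8 (x - y)], hence [40 z]. *)
have solve (x y z u v c : int) : x - y = 5 * z ->
  8 * x = 2 * (4 * y) + u - 2 * v -> u - 2 * v = 40 * c -> z = c by lia.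
case: existsP => [[[k /= _] /eqP kn]|nk] AB.
  have k0 : (0 < k)%N by move: n0; rewrite -kn; case: (k).
  have := sum_cubic_weight_square k0; rewrite /= kn -/s => sq E.
  have -> : n%:Z = k%:Z ^+ 2 by rewrite -kn -mulnn PoszM.
  exact: solve AB E sq.
have nsq k : (k ^ 2)%N != n.
  apply/negP => /eqP e; apply: nk; have lt : (k < n.+1)%N by nia.
  by exists (Ordinal lt); rewrite /= e.
have [F1 _] := sum_square_div_triples_nonsquare
  (fun t => cubic_weight (t.1.2 + t.2) t.1.1 (t.1.2 - t.2)) nsq.
have [_ F2] := sum_square_div_triples_nonsquare
  (fun t => cubic_weight (t.2 - 2 * t.1.1) (t.1.2 + t.1.1)
      (2 * t.1.2 + 2 * t.1.1 - t.2)) nsq.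
by rewrite F1 F2 => E; apply: solve AB E _.
Qed.

(** * Jacobi's four square theorem *)

(** A truncation of the theta series [sum_i X^(i^2)]; it keeps every square up to [n], so the
    coefficients of its powers are exact up to degree [n]. *)
Definition theta_poly (n : nat) : {poly int} :=
  \sum_(i <- int_range n) 'X^(`|i| ^ 2).

(* The number of representations of [n] as a sum of four squares, by
   [coef_theta_poly4]. *)
Definition jacobi_count (n : nat) : int :=
  (n == 0%N)%:R + 8 * four_square_divisor_sum n.

(** If [m = k^2], the extra 1 in [jacobi_count 0] contributes [m - 5 m] at each of [i = k] and
    [i = -k], which cancels 8 times the right-hand side [m] of the divisor recurrence. The range
    depends on [n] to match the sums coming from [theta_poly n]. *)
Lemma jacobi_count_rec (n m : nat) : (0 < m)%N -> (m <= n)%N ->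
  \sum_(i <- int_range n | (`|i| ^ 2 <= m)%N)
    (m%:Z - 5 * i ^+ 2) * jacobi_count (m - `|i| ^ 2) = 0.
Proof.
move=> m0 mn; have ur := int_range_uniq.
have -> : \sum_(i <- int_range n | (`|i| ^ 2 <= m)%N)
    (m%:Z - 5 * i ^+ 2) * jacobi_count (m - `|i| ^ 2) =
  \sum_(i <- int_range n | (`|i| ^ 2 == m)%N) (- 4 * m%:Z) +
  8 * \sum_(i <- int_range m | (`|i| ^ 2 < m)%N)
    (m%:Z - 5 * i ^+ 2) * four_square_divisor_sum (m - `|i| ^ 2).
  have -> : \sum_(i <- int_range m | (`|i| ^ 2 < m)%N)
      (m%:Z - 5 * i ^+ 2) * four_square_divisor_sum (m - `|i| ^ 2) =
    \sum_(i <- int_range n | (`|i| ^ 2 < m)%N)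
      (m%:Z - 5 * i ^+ 2) * four_square_divisor_sum (m - `|i| ^ 2).
    apply: (@big_seq_bij _ _ _ _ _ _ (fun i => (`|i| ^ 2 < m)%N) id id (fun i =>
      (m%:Z - 5 * i ^+ 2) * four_square_divisor_sum (m - `|i| ^ 2))) => //.
      by move=> i; rewrite !mem_int_range => im lt; split=> //; lia.
    by move=> i; rewrite !mem_int_range => im lt; split=> //; nia.
  rewrite mulr_sumr big_mkcond [X in X + _]big_mkcond [X in _ + X]big_mkcond.
  rewrite -big_split; apply: eq_bigr => i _ /=; rewrite /jacobi_count subn_eq0.
  rewrite -abszX2.
  case: ltngtP => [lt|lt|->] /=; [ring|ring|].
  by rewrite subnn four_square_divisor_sum0; ring.
rewrite four_square_divisor_sum_rec //; case: existsP => [[[k /= _] /eqP km]|nk].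
  have k0 : (0 < k)%N by move: m0; rewrite -km; case: (k).
  have -> : \sum_(i <- int_range n | (`|i| ^ 2 == m)%N) (- 4 * m%:Z) =
            \sum_(i <- [:: k%:Z; - k%:Z]) (- 4 * m%:Z).
    apply: (@big_seq_bij _ _ _ _ _ _ xpredT id id (fun=> - 4 * m%:Z)) => //.
    - by rewrite /= inE andbT; apply/eqP; lia.
    - move=> i _ /eqP; rewrite -km => /eqP; rewrite eqn_exp2r // !inE => /eqP e.
      by split=> //; apply/orP; lia.
    move=> i; rewrite mem_int_range !inE => /orP[] /eqP -> _;
      by rewrite ?abszN /= km eqxx; split=> //; nia.
  by rewrite !big_cons big_nil; ring.
rewrite big1 ?mulr0 ?addr0 // => i /eqP e; case: nk.
have lt : (`|i| < m.+1)%N by nia.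
by exists (Ordinal lt); rewrite /= e.
Qed.

Lemma coef_theta_polyM (n m : nat) (p : {poly int}) :
  (p * theta_poly n)`_m =
  \sum_(i <- int_range n | (`|i| ^ 2 <= m)%N) p`_(m - `|i| ^ 2).
Proof.
rewrite /theta_poly mulr_sumr coef_sum [RHS]big_mkcond; apply: eq_bigr => i _.
by rewrite coefMXn ltnNge; case: leqP.
Qed.

Lemma coef_theta_poly4_rec (n m : nat) :
  \sum_(i <- int_range n | (`|i| ^ 2 <= m)%N)
    (m%:Z - 5 * i ^+ 2) * (theta_poly n ^+ 4)`_(m - `|i| ^ 2) = 0.
Proof.
set p := theta_poly n ^+ 4.
(* The factor ['X] makes the derivative multiply each coefficient by its own index. *)
have E : ('X * p^`()) * theta_poly n = (p * ('X * (theta_poly n)^`())) *+ 4.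
  by rewrite /p deriv_exp /=; ring.
have L : (('X * p^`()) * theta_poly n)`_m =
    \sum_(i <- int_range n | (`|i| ^ 2 <= m)%N)
      (m%:Z - i ^+ 2) * p`_(m - `|i| ^ 2).
  rewrite coef_theta_polyM; apply: eq_bigr => i le.
  rewrite -abszX2.
  rewrite subzn // coefXM coef_deriv; case: (m - _)%N => [|k] /=; first by rewrite mul0r.
  by rewrite -mulr_natl natz.
have R : (p * ('X * (theta_poly n)^`()))`_m =
    \sum_(i <- int_range n | (`|i| ^ 2 <= m)%N)
      i ^+ 2 * p`_(m - `|i| ^ 2).
  have -> : 'X * (theta_poly n)^`() =
      \sum_(i <- int_range n) 'X^(`|i| ^ 2) *+ (`|i| ^ 2).
    rewrite /theta_poly raddf_sum mulr_sumr; apply: eq_bigr => i _ /=.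
    by rewrite derivXn mulrnAr; case: (`|i| ^ 2)%N => [|k]; rewrite ?mulr0n //= -exprS.
  rewrite mulr_sumr coef_sum [RHS]big_mkcond; apply: eq_bigr => i _.
  rewrite mulrnAr coefMn coefMXn ltnNge.
  rewrite -abszX2.
  by case: leqP => _ /=; rewrite ?mul0rn // -mulr_natl natz.
move/(congr1 (fun q : {poly int} => q`_m)): E; rewrite coefMn L R => E.
rewrite (eq_bigr (fun i : int => (m%:Z - i ^+ 2) * p`_(m - `|i| ^ 2)
    - (i ^+ 2 * p`_(m - `|i| ^ 2)) *+ 4)); last by move=> i _; ring.
by rewrite sumrB E sumrMnl subrr.
Qed.

(** Both sides are 1 at index 0 and satisfy the same recurrence, in which [i = 0] gives [m] times
    the value at [m] and all other terms involve smaller indices. *)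
Lemma coef_theta_poly4 (n m : nat) : (m <= n)%N ->
  (theta_poly n ^+ 4)`_m = jacobi_count m.
Proof.
have [k] := ubnP m; elim: k m => // k IH m mk mn.
have u0 : 0 \in int_range n by rewrite mem_int_range.
have ur := int_range_uniq n.
have [->|m0] := posnP m.
  rewrite -horner_coef0 hornerE /jacobi_count four_square_divisor_sum0 mulr0.
  rewrite (_ : (theta_poly n).[0] = 1) ?expr1n //.
  rewrite /theta_poly horner_sum (bigD1_seq 0) //= hornerXn /= big_seq_cond big1 ?addr0 //.
  by move=> i /andP[_ i0]; rewrite hornerXn expr0n expn_eq0 absz_eq0 (negPf i0).
have := etrans (coef_theta_poly4_rec n m) (esym (jacobi_count_rec m0 mn)).
rewrite -big_filter -[RHS]big_filter.
have uf : uniq [seq i <- int_range n | (`|i| ^ 2 <= m)%N] by rewrite filter_uniq.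
have f0 : 0 \in [seq i <- int_range n | (`|i| ^ 2 <= m)%N] by rewrite mem_filter u0.
rewrite (bigD1_seq 0) // [RHS](bigD1_seq 0) // absz0 exp0n // subn0 expr0n mulr0 subr0.
rewrite (_ : \sum_(i <- _ | i != 0) _ =
  \sum_(i <- [seq i <- int_range n | (`|i| ^ 2 <= m)%N] | i != 0)
    (m%:Z - 5 * i ^+ 2) * jacobi_count (m - `|i| ^ 2)).
  by move=> /addIr; apply: mulfI; lia.
rewrite big_seq_cond [RHS]big_seq_cond; apply: eq_bigr => i /andP[].
rewrite mem_filter => /andP[im _] i0; rewrite IH //; last by lia.
have : (0 < `|i| ^ 2)%N by rewrite expn_gt0 absz_gt0 i0.
lia.
Qed.

(** * Convolution sums over the natural numbers *)

Lemma sigma_div (t n : nat) : (0 < t)%N ->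
  sigma (n%:R / t%:R) = (sum_divisors_quot t n)%:Z.
Proof.
move=> t0; rewrite /sigma /sum_divisors_quot.
have tn0 : t%:R != 0 :> rat by rewrite pnatr_eq0 -lt0n.
case: ifP => [/natrP[m e]|nn].
  have nE : n = (m * t)%N.
    by apply/eqP; rewrite -(eqr_nat rat) natrM -e divfK.
  by rewrite e natrK nE dvdn_mull // mulnK.
case: ifP => // /dvdnP[m nE]; move: nn.
by rewrite nE natrM mulfK // natr_nat.
Qed.

Lemma sigma_nat (n : nat) : sigma n%:R = (sum_divisors n)%:Z.
Proof.
by have := sigma_div n (ltn0Sn 0); rewrite divr1 /sum_divisors_quot dvd1n divn1.
Qed.

(** Arbitrary functions [u] and [v] are allowed so that bilinearity can be used; for [a, b > 0] the
    bounds lose no solution of [a l + b m = n]. *)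
Definition conv_sum (a b n : nat) (u v : nat -> int) : int :=
  \sum_(0 <= l < n.+1) \sum_(0 <= m < n.+1 | (a * l + b * m == n)%N) u l * v m.

Lemma W_div (a b t n : nat) : (0 < a)%N -> (0 < b)%N -> (0 < t)%N ->
  W a b (n%:R / t%:R) =
  conv_sum (a * t) (b * t) n (Posz \o sum_divisors) (Posz \o sum_divisors).
Proof.
move=> a0 b0 t0; pose box := [seq (l, m) | l <- index_iota 0 n.+1, m <- index_iota 0 n.+1].
pose r := [seq lm <- box | (a * t * lm.1 + b * t * lm.2 == n)%N].
have tn0 : t%:R != 0 :> rat by rewrite pnatr_eq0 -lt0n.
have ur : uniq r.
  by apply/filter_uniq/allpairs_uniq; rewrite ?iota_uniq // => -[? ?] [? ?].
(* After the denominator [t] is cleared, the index set is a duplicate-free list, so the finitely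
   supported sum becomes an ordinary one. *)
rewrite /W; have -> : convolution_pairs a b (n%:R / t%:R) = [set` r]%classic.
  apply/predeqP => -[l m]; rewrite /convolution_pairs /= mem_filter /=.
  have -> : (a%:R * l%:R + b%:R * m%:R = n%:R / t%:R :> rat) <->
      (a * t * l + b * t * m == n)%N.
    rewrite -(eqr_nat rat) natrD !natrM; split => [e|/eqP <-].
      by apply/eqP/(mulIf (invr_neq0 tn0)); rewrite -e; field.
    by field.
  split=> [e|/andP[]//]; rewrite e; apply: allpairs_f; rewrite mem_index_iota ltnS.
    by rewrite -(eqP e) (leq_trans _ (leq_addr _ _)) // leq_pmull ?muln_gt0 ?a0.
  by rewrite -(eqP e) (leq_trans _ (leq_addl _ _)) // leq_pmull ?muln_gt0 ?b0.
rewrite -fsbig_seq // big_filter big_mkcond /box big_allpairs /=.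
rewrite /conv_sum; apply: eq_bigr => l _; rewrite [RHS]big_mkcond.
by apply: eq_bigr => m _; rewrite !sigma_nat.
Qed.

(** Only multiples of [t] contribute on the left; since [phi] vanishes beyond [n], both sums can
    keep the same bound. *)
Lemma sum_scaled (t n : nat) (v : nat -> int) (phi : nat -> int) : (0 < t)%N ->
  (forall m, (n < m)%N -> phi m = 0) ->
  \sum_(0 <= m < n.+1) (if (t %| m)%N then v (m %/ t)%N else 0) * phi m =
  \sum_(0 <= m < n.+1) v m * phi (t * m)%N.
Proof.
move=> t0 phi0.
rewrite (bigID (fun m => (t %| m)%N)) /= [X in _ + X]big1 ?addr0; last first.
  by move=> m /negPf ->; rewrite mul0r.
rewrite [RHS](bigID (fun m => (t * m <= n)%N)) /= [X in _ = _ + X]big1 ?addr0; last first.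
  by move=> m; rewrite -ltnNge => /phi0 ->; rewrite mulr0.
have ui : uniq (index_iota 0 n.+1) := iota_uniq _ _.
rewrite -(@big_seq_bij _ _ _ (index_iota 0 n.+1) _ (fun m => t * m <= n)%N
  (dvdn t) (muln t) (divn^~ t)
  (fun m => (if (t %| m)%N then v (m %/ t)%N else 0) * phi m)) //.
- by apply: eq_bigr => m _; rewrite dvdn_mulr // mulKn.
- by move=> m; rewrite !mem_index_iota => _ mn; rewrite dvdn_mulr // mulKn.
move=> m; rewrite !mem_index_iota => mn /dvdnP[k mE]; rewrite mE mulnK // (mulnC t) -mE.
by split=> //; rewrite (leq_ltn_trans _ mn) // mE leq_pmulr.
Qed.

Lemma conv_sum_scaled_l (a b t n : nat) (u v : nat -> int) : (0 < a)%N -> (0 < t)%N ->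
  conv_sum a b n (fun l => if (t %| l)%N then u (l %/ t)%N else 0) v =
  conv_sum (a * t) b n u v.
Proof.
move=> a0 t0; rewrite /conv_sum.
under eq_bigr do rewrite -mulr_sumr.
rewrite (@sum_scaled t n u (fun l =>
  \sum_(0 <= m < n.+1 | (a * l + b * m == n)%N) v m)) //.
  by apply: eq_bigr => l _; rewrite mulr_sumr mulnA.
move=> l nl; rewrite big1 // => m /eqP e.
suff : (n < n)%N by rewrite ltnn.
by rewrite -{2}e (leq_trans nl) // (leq_trans _ (leq_addr _ _)) // leq_pmull.
Qed.

Lemma conv_sumC (a b n : nat) (u v : nat -> int) :
  conv_sum a b n u v = conv_sum b a n v u.
Proof.
rewrite /conv_sum; under eq_bigr do rewrite big_mkcond.
rewrite exchange_big; apply: eq_bigr => l _; rewrite -big_mkcond.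
by apply: eq_big => m; rewrite 1?addnC // => _; rewrite mulrC.
Qed.

Lemma conv_sum_scaled_r (a b t n : nat) (u v : nat -> int) : (0 < b)%N -> (0 < t)%N ->
  conv_sum a b n u (fun m => if (t %| m)%N then v (m %/ t)%N else 0) =
  conv_sum a (b * t) n u v.
Proof. by move=> b0 t0; rewrite conv_sumC conv_sum_scaled_l // conv_sumC. Qed.

Lemma conv_sum_delta_l (b n : nat) (u : nat -> int) : (0 < b)%N ->
  conv_sum 1 b n (fun l => (l == 0%N)%:R) u =
  if (b %| n)%N then u (n %/ b)%N else 0.
Proof.
move=> b0; rewrite /conv_sum big_nat_recl //= [X in _ + X]big1 ?addr0; last first.
  by move=> i _; rewrite big1 // => m _; rewrite mul0r.
under eq_bigr do rewrite mul1r.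
under eq_bigl do rewrite muln0 add0n.
case: ifP => [/dvdnP[k ->]|nd].
  rewrite mulnK // big_mkcond (bigD1_seq k) ?iota_uniq //=; last first.
    by rewrite mem_index_iota ltnS leq_pmulr.
  rewrite mulnC eqxx big1 ?addr0 // => i ik.
  by rewrite (mulnC k) eqn_pmul2l // (negPf ik).
by rewrite big1 // => m /eqP e; move: nd; rewrite -e dvdn_mulr.
Qed.

Lemma conv_sumDl (a b n : nat) (u1 u2 v : nat -> int) :
  conv_sum a b n (fun l => u1 l + u2 l) v = conv_sum a b n u1 v + conv_sum a b n u2 v.
Proof.
rewrite /conv_sum -big_split; apply: eq_bigr => l _; rewrite -big_split.
by apply: eq_bigr => m _; rewrite mulrDl.
Qed.

Lemma conv_sumZl (a b n : nat) (c : int) (u v : nat -> int) :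
  conv_sum a b n (fun l => c * u l) v = c * conv_sum a b n u v.
Proof.
rewrite /conv_sum mulr_sumr; apply: eq_bigr => l _; rewrite mulr_sumr.
by apply: eq_bigr => m _; rewrite mulrA.
Qed.

Lemma conv_sumDr (a b n : nat) (u v1 v2 : nat -> int) :
  conv_sum a b n u (fun l => v1 l + v2 l) = conv_sum a b n u v1 + conv_sum a b n u v2.
Proof. by rewrite conv_sumC conv_sumDl !(conv_sumC b a). Qed.

Lemma conv_sumZr (a b n : nat) (c : int) (u v : nat -> int) :
  conv_sum a b n u (fun l => c * v l) = c * conv_sum a b n u v.
Proof. by rewrite conv_sumC conv_sumZl (conv_sumC b a). Qed.

Lemma eq_conv_sum (a b n : nat) (u u' v v' : nat -> int) :
  u =1 u' -> v =1 v' -> conv_sum a b n u v = conv_sum a b n u' v'.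
Proof.
by move=> eu ev; apply: eq_bigr => l _; apply: eq_bigr => m _; rewrite eu ev.
Qed.

(** Bilinear expansion of [jacobi_count = delta + 8 s - 32 q], where [q] is [s] dilated by 4:
    products with one [delta] give the single divisor sums, and a factor [q] multiplies the
    corresponding coefficient of the form by 4. *)
Lemma conv_sum_jacobi_count (b n : nat) : (0 < b)%N -> (0 < n)%N ->
  let s := Posz \o sum_divisors in
  conv_sum 1 b n jacobi_count jacobi_count =
  8 * (sum_divisors n)%:Z - 32 * (sum_divisors_quot 4 n)%:Z
  + 8 * (sum_divisors_quot b n)%:Z - 32 * (sum_divisors_quot (4 * b) n)%:Z
  + 64 * conv_sum 1 b n s s + 1024 * conv_sum 4 (b * 4) n s s
  - 256 * (conv_sum 4 b n s s + conv_sum 1 (4 * b) n s s).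
Proof.
move=> b0 n0 s.
pose q l : int := if (4 %| l)%N then s (l %/ 4)%N else 0.
pose delta l : int := (l == 0%N)%:R.
have qE l : (sum_divisors_quot 4 l)%:Z = q l.
  by rewrite /q /sum_divisors_quot; case: ifP.
have fE : jacobi_count =1 (fun l => (delta l + 8 * s l) + -32 * q l).
  move=> l; rewrite /jacobi_count /four_square_divisor_sum qE /delta /s /=; ring.
rewrite (eq_conv_sum _ _ _ fE fE) !conv_sumDl !conv_sumZl !conv_sumDr !conv_sumZr.
rewrite !(conv_sumC _ _ _ s delta) !(conv_sumC _ _ _ q delta).
rewrite !conv_sum_delta_l //.
have dr u : conv_sum b 1 n delta u = u n.
  rewrite conv_sumC /conv_sum.
  rewrite (bigD1_seq n) ?iota_uniq ?mem_index_iota ?ltnS //=.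
  rewrite big_mkcond big_nat_recl //= mul1n muln0 addn0 eqxx mulr1.
  rewrite [X in _ + X + _]big1 ?addr0; last first.
    by move=> m _; rewrite /delta mulr0; case: ifP.
  rewrite big1 ?addr0 // => l ln; rewrite big_mkcond big_nat_recl //=.
  rewrite mul1n muln0 addn0 (negPf ln) add0r big1 // => m _.
  by rewrite /delta mulr0; case: ifP.
rewrite !dr (conv_sum_scaled_l b n s s (ltn0Sn 0) (ltn0Sn 3)).
rewrite (conv_sum_scaled_r 1 n s s b0 (ltn0Sn 3)).
rewrite (conv_sum_scaled_l b n s q (ltn0Sn 0) (ltn0Sn 3)).
rewrite (conv_sum_scaled_r _ n s s b0 (ltn0Sn 3)) -!qE mul1n (mulnC 4).
(* The product of the two [delta] is concentrated at [n = 0]. *)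
have -> : (if (b %| n)%N then (n %/ b == 0)%N%:R else 0) = 0 :> int.
  case: ifP => // /dvdnP[k nE]; move: n0; rewrite nE mulnK //.
  by case: k {nE}.
have -> : (if (b %| n)%N then s (n %/ b)%N else 0) = (sum_divisors_quot b n)%:Z.
  by rewrite /sum_divisors_quot; case: ifP.
have -> : (if (b %| n)%N then (sum_divisors_quot 4 (n %/ b))%:Z else 0) =
    (sum_divisors_quot (b * 4) n)%:Z.
  rewrite /sum_divisors_quot; case: ifP => [/dvdnP[k ->]|nd]; last first.
    by case: ifP => // d; rewrite (dvdn_trans (dvdn_mulr 4 (dvdnn b)) d) in nd.
  by rewrite mulnK // (mulnC b 4) dvdn_pmul2r // divnMr //.
rewrite /s /=; ring.
Qed.

(** * Representation numbers as coefficients of theta products *)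

(** Expanding the eight theta factors yields one monomial per point of the box [[-n, n]^8], with the
    value of the form as exponent; every representation of [n] lies in that box. *)
Lemma N_coef (a b n : nat) : (0 < a)%N -> (0 < b)%N ->
  (N a b n)%:Z =
  ((theta_poly n ^+ 4 \Po 'X^a) * (theta_poly n ^+ 4 \Po 'X^b))`_n.
Proof.
move=> a0 b0.
(* The coefficient of each coordinate, which merges the two blocks into one product over eight
   indices; [h] shifts indices [0..2n] to [-n..n]. *)
pose c (i : 'I_(4 + 4)) := if fintype.split i is inl _ then a else b.
pose h (g : {ffun 'I_(4 + 4) -> 'I_(n.*2.+1)}) : {ffun 'I_(4 + 4) -> int} :=
  [ffun i => (g i)%:Z - n%:Z].
have c0 i : (0 < c i)%N by rewrite /c; case: fintype.split.
have cl i : c (lshift 4 i) = a by rewrite /c (unsplitK (inl i)).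
have cr i : c (rshift 4 i) = b by rewrite /c (unsplitK (inr i)).
have octE x : octonary_form a b x = (\sum_i c i * `|x i| ^ 2)%N%:Z.
  rewrite /octonary_form big_split_ord /= PoszD.
  rewrite !(big_morph Posz PoszD (erefl 0%:Z)) !mulr_sumr.
  by congr (_ + _); apply: eq_bigr => i _;
    rewrite ?cl ?cr PoszM natz abszX2.
have hinj : injective h.
  move=> f g /ffunP e; apply/ffunP => i; apply: val_inj.
  by have := e i; rewrite !ffunE /=; lia.
pose G := [set g | (\sum_i c i * `|h g i| ^ 2 == n)%N].
have -> : N a b n = #|G|.
  rewrite /N (_ : fset_set _ = [fset h g | g in G]%fset).
    by rewrite card_imfset //= -cardE.
  apply/fsetP => x; rewrite in_fset_set; last exact: finite_representations.
  apply/idP/imfsetP => /= [|[g]].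
    rewrite inE /= /representations /= octE => -[e].
    have xn i : (`|x i| <= n)%N.
      rewrite e (bigD1 i) //=; apply: leq_trans (leq_addr _ _).
      by apply: leq_trans (leq_pmull _ (c0 i)); rewrite -mulnn; nia.
    have bd i : (absz (x i + n%:Z)%R < n.*2.+1)%N by have := xn i; lia.
    have xE : x = h [ffun i => Ordinal (bd i)].
      by apply/ffunP => i; rewrite !ffunE /=; move: (x i : int) (xn i) => y; lia.
    by exists [ffun i => Ordinal (bd i)]; rewrite // inE -xE -e.
  by rewrite !inE => /eqP e ->; rewrite /representations /= octE e.
have thetaE d : theta_poly n \Po 'X^d =
    \sum_(j : 'I_(n.*2.+1)) 'X^(d * `|j%:Z - n%:Z| ^ 2).
  rewrite /theta_poly raddf_sum (_ : int_range n =
    [seq j%:Z - n%:Z | j <- index_iota 0 n.*2.+1]); last by rewrite /index_iota subn0.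
  rewrite big_map big_mkord; apply: eq_bigr => j _.
  by rewrite /= rmorphXn /= comp_polyX -exprM.
have powE d : theta_poly n ^+ 4 \Po 'X^d =
    \prod_(i < 4) \sum_(j : 'I_(n.*2.+1)) 'X^(d * `|j%:Z - n%:Z| ^ 2).
  by rewrite rmorphXn /= thetaE prodr_const card_ord.
rewrite !powE.
have -> : \prod_(i < 4) (\sum_(j : 'I_(n.*2.+1)) 'X^(a * `|j%:Z - n%:Z| ^ 2))
   * \prod_(i < 4) (\sum_(j : 'I_(n.*2.+1)) 'X^(b * `|j%:Z - n%:Z| ^ 2)) =
   \prod_(i < 4 + 4) (\sum_(j : 'I_(n.*2.+1)) 'X^(c i * `|j%:Z - n%:Z| ^ 2))
   :> {poly int}.
  rewrite [RHS]big_split_ord; congr (_ * _);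
    by apply: eq_bigr => i _; rewrite ?cl ?cr.
rewrite bigA_distr_bigA coef_sum -sum1_card (big_morph Posz PoszD (erefl 0%:Z)).
rewrite big_mkcond; apply: eq_bigr => g _.
rewrite prodrXr coefXn inE eq_sym.
under [in RHS]eq_bigr do rewrite -[_ - _](ffunE (fun i => (g i)%:Z - n%:Z)).
by case: eqP.
Qed.

(** The coefficient of index [n - l] in [theta^4] composed with ['X^b] is nonzero only if
    [n - l = b k], which singles out the term [m = k] of the inner sum. *)
Lemma N1_conv_sum (b n : nat) : (0 < b)%N ->
  (N 1 b n)%:Z = conv_sum 1 b n jacobi_count jacobi_count.
Proof.
move=> b0; rewrite N_coef // expr1 comp_polyXr coefM /conv_sum big_mkord.
apply: eq_bigr => l _; have ln : (l <= n)%N by rewrite -ltnS.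
rewrite coef_theta_poly4 // -mulr_sumr coef_comp_poly_Xn //; congr (_ * _).
case: ifP => [/dvdnP[k e]|nd].
  have kn : (k <= n)%N by rewrite (leq_trans _ (leq_subr l n)) // e leq_pmulr.
  rewrite e mulnK // coef_theta_poly4 // big_mkcond (bigD1_seq k) ?iota_uniq //=.
    rewrite mul1n mulnC -e subnKC // eqxx big1 ?addr0 // => i ik.
    case: ifP => // /eqP E; case/eqP: ik; apply/eqP.
    by rewrite -(eqn_pmul2l b0); apply/eqP; lia.
  by rewrite mem_index_iota ltnS.
by rewrite big1 // => m /eqP E; case/negP: nd; apply/dvdnP; exists m; lia.
Qed.

(** Uniform in [b]; the values 11 and 13 turn [4 * b] into 44 and 52. *)
Lemma N1_formula (b n : nat) : (0 < b)%N -> (0 < n)%N ->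
  (N 1 b n)%:Z =
      8 * sigma n%:R - 32 * sigma (n%:R / 4)
      + 8 * sigma (n%:R / b%:R) - 32 * sigma (n%:R / (4 * b)%:R)
      + 64 * W 1 b n%:R + 1024 * W 1 b (n%:R / 4)
      - 256 * (W 4 b n%:R + W 1 (4 * b) n%:R).
Proof.
move=> b0 n0; have W1 a c : (0 < a)%N -> (0 < c)%N -> W a c n%:R =
    conv_sum a c n (Posz \o sum_divisors) (Posz \o sum_divisors).
  by move=> a0 c0; have := @W_div a c 1 n a0 c0 isT; rewrite divr1 !muln1.
have b40 : (0 < 4 * b)%N by rewrite muln_gt0.
rewrite N1_conv_sum // conv_sum_jacobi_count // !W1 // W_div // mul1n.
by rewrite sigma_nat !sigma_div.
Qed.

Theorem theorem4p1 (n : nat) (n_gt0 : (0 < n)%N) :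
  (N 1 11 n)%:Z =
      8 * sigma n%:Q - 32 * sigma (n%:Q / 4)
      + 8 * sigma (n%:Q / 11) - 32 * sigma (n%:Q / 44)
      + 64 * W 1 11 n%:Q + 1024 * W 1 11 (n%:Q / 4)
      - 256 * (W 4 11 n%:Q + W 1 44 n%:Q)
  /\
  (N 1 13 n)%:Z =
      8 * sigma n%:Q - 32 * sigma (n%:Q / 4)
      + 8 * sigma (n%:Q / 13) - 32 * sigma (n%:Q / 52)
      + 64 * W 1 13 n%:Q + 1024 * W 1 13 (n%:Q / 4)
      - 256 * (W 4 13 n%:Q + W 1 52 n%:Q).
Proof. by rewrite -pmulrn; split; apply: N1_formula. Qed.
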